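(* Let $d\ge 1$ be an integer. For every $k\in\mathbb{N}$ and every $x,y\in[0,1]^d$, $$p^{sd}_k(x,y)=p_k(x,y)=K^{Cen}_k(x,y),$$ where $p_k(x,y)$ is the probability that $x$ and $y$ belong to the same cell of a random centered tree of level $k$, $p^{sd}_k(x,y)$ is the probability that $x$ and $y$ belong to the same cell of a random simplified directional tree of level $k$, and $$K^{Cen}_k(x,y)=\sum_{\substack{k_1,\dots,k_d\ge 0\\ k_1+\cdots+k_d=k}}\frac{k!}{k_1!\cdots k_d!}\Big(\frac1d\Big)^k\prod_{j=1}^d \mathbf{1}_{\lceil 2^{k_j}x_j\rceil=\lceil 2^{k_j}y_j\rceil}.$$
   Context: Both trees are random partitions of $[0,1]^d$ into $2^k$ cells (axis-parallel boxes), constructed independently of any data. Centered tree of level $k$: start from the single cell $[0,1]^d$ and repeat the following $k$ times. For each current cell (node) separately, choose a coordinate uniformly at random from $\{1,\dots,d\}$ (all choices at all nodes being independent), and split that cell into two at the midpoint of its side in the chosen coordinate. Simplified directional tree of level $k$: start from the single cell $[0,1]^d$ and repeat the following $k$ times. Choose one single coordinate uniformly at random from $\{1,\dots,d\}$ (independently across the $k$ steps), and split every current cell into two at the midpoint of its side in that common coordinate. Boundary convention: a cell obtained after being split $m_j$ times in coordinate $j$ (for $j=1,\dots,d$) is identified with a class of points $z\in[0,1]^d$ sharing the same values $\lceil 2^{m_j}z_j\rceil$, $j=1,\dots,d$. That is, two points are separated by the successive splits of a common cell along coordinate $j$ exactly according to whether $\lceil 2^{m_j}x_j\rceil\neq\lceil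 2^{m_j}y_j\rceil$. *)

(* Defs.v *)
From mathcomp Require Import all_boot all_order all_algebra.
From mathcomp Require Import reals.

Set Implicit Arguments.
Unset Strict Implicit.
Unset Printing Implicit Defensive.

Import Order.TTheory GRing.Theory Num.Theory.
Local Open Scope ring_scope.

Definition in_cube (R : realType) (d : nat) (z : 'rV[R]_d) : Prop :=
  forall j : 'I_d, 0 <= z 0 j <= 1.

(* [nsplit b j] is the number m_j of times that the box has been split in
   coordinate j. *)
Record box (R : realType) (d : nat) := Box {
  lo : 'rV[R]_d;
  hi : 'rV[R]_d;
  nsplit : 'I_d -> nat
}.

Definition cube_box (R : realType) (d : nat) : box R d :=
  Box (const_mx 0) (const_mx 1) (fun=> 0%N).

Definition set_coord (R : realType) (d : nat) (v : 'rV[R]_d) (c : 'I_d)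
    (t : R) : 'rV[R]_d :=
  \row_j (if j == c then t else v 0 j).

(* The half of [b], cut at the midpoint of its side in coordinate [c]: the
   upper half for [true], the lower half for [false]. *)
Definition half (R : realType) (d : nat) (b : box R d) (c : 'I_d)
    (upper : bool) : box R d :=
  let mid := (lo b 0 c + hi b 0 c) / 2%:R in
  let m := fun j => if j == c then (nsplit b j).+1 else nsplit b j in
  if upper then Box (set_coord (lo b) c mid) (hi b) m
  else Box (lo b) (set_coord (hi b) c mid) m.

(* Sides are closed on the right, since {t | ceil (2^m t) = i} is the interval
   ](i - 1) / 2^m, i / 2^m]; a side starting at 0 also contains 0, so that the
   boxes of a tree cover the whole cube. *)
Definition in_box (R : realType) (d : nat) (b : box R d) (z : 'rV[R]_d) : bool :=
  [forall j : 'I_d,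
    (if lo b 0 j == 0 then 0 <= z 0 j else lo b 0 j < z 0 j)
    && (z 0 j <= hi b 0 j)].

Definition same_ceil (R : realType) (d : nat) (m : 'I_d -> nat)
    (x y : 'rV[R]_d) : bool :=
  [forall j : 'I_d,
    Num.ceil (2%:R ^+ m j * x 0 j) == Num.ceil (2%:R ^+ m j * y 0 j)].

(* Boundary convention: within a box, a cell is a class of points sharing the
   values ceil (2^(m_j) z_j).  For points with positive coordinates this is
   implied by membership in the box; it only separates the points with z_j = 0
   (where the ceiling is 0) from those with z_j > 0 (where it is at least 1). *)
Definition same_cell (R : realType) (d : nat) (bs : seq (box R d))
    (x y : 'rV[R]_d) : bool :=
  has (fun b => [&& in_box b x, in_box b y & same_ceil (nsplit b) x y]) bs.

(* The law of a family, indexed by [I], of independent coordinates that are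
   uniform on {1, ..., d}: every outcome [w] has probability \prod_i (1 / d). *)
Definition prob_iid (R : realType) (d : nat) (I : finType)
    (E : pred {ffun I -> 'I_d}) : R :=
  \sum_(w : {ffun I -> 'I_d} | E w) \prod_(i : I) d%:R^-1.

(* A node is addressed by the halves taken on the way from the root.  The nodes
   that are split in a tree of level k are those of depth at most k - 1, that
   is the elements of [k.-1.-bseq bool] (for k = 0 this type still contains the
   root, whose coordinate is then not used). *)
Definition node (k : nat) : finType := k.-1.-bseq bool.

Fixpoint centered_nodes (R : realType) (d : nat) (choice : seq bool -> 'I_d)
    (l : nat) : seq (seq bool * box R d) :=
  if l is l'.+1 then
    flatten [seq [seq (rcons vb.1 u, half vb.2 (choice vb.1) u)
                 | u <- [:: false; true]]
            | vb <- centered_nodes R choice l']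
  else [:: ([::], cube_box R d)].

(* [insub_bseq] is the identity on the addresses of size at most k - 1, which
   are the only ones met while growing the tree. *)
Definition centered_tree (R : realType) (d k : nat)
    (w : {ffun node k -> 'I_d}) : seq (box R d) :=
  unzip2 (centered_nodes R (fun v => w (insub_bseq k.-1 v)) k).

Definition split_all (R : realType) (d : nat) (bs : seq (box R d)) (c : 'I_d)
    : seq (box R d) :=
  flatten [seq [seq half b c u | u <- [:: false; true]] | b <- bs].

Definition directional_tree (R : realType) (d k : nat)
    (w : {ffun 'I_k -> 'I_d}) : seq (box R d) :=
  foldl (@split_all R d) [:: cube_box R d] (codom w).

Definition p_cen (R : realType) (d k : nat) (x y : 'rV[R]_d) : R :=
  prob_iid R (fun w : {ffun node k -> 'I_d} => same_cell (centered_tree R w) x y).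

Definition p_sd (R : realType) (d k : nat) (x y : 'rV[R]_d) : R :=
  prob_iid R (fun w : {ffun 'I_k -> 'I_d} => same_cell (directional_tree R w) x y).

(* The bound k_j <= k carried by 'I_k.+1 follows from k_1 + ... + k_d = k. *)
Definition K_cen (R : realType) (d k : nat) (x y : 'rV[R]_d) : R :=
  \sum_(kk : {ffun 'I_d -> 'I_k.+1} | (\sum_j kk j)%N == k)
    (k`!%:R / (\prod_j (kk j)`!%:R)) * (1 / d%:R) ^+ k *
    \prod_j (Num.ceil (2%:R ^+ kk j * x 0 j)
             == Num.ceil (2%:R ^+ kk j * y 0 j))%:R.

(* Main.v *)
(* Whatever the tree, exactly one box of each level contains x, and y lies in
   the same cell iff the ceilings agree for the split counts of that box.  So
   only the k coordinates c_1, ..., c_k chosen along the way down to x matter.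
   In the directional tree they are the k i.i.d. choices themselves.  In the
   centered tree, (c_1, ..., c_k) = c iff k specified nodes, the ones that x
   traverses when the choices are c, carry the labels c_1, ..., c_k; since these
   nodes are distinct, this event has probability d^(-k), so both laws agree.
   Grouping the words c by their letter counts gives the multinomial sum. *)
From mathcomp Require Import all_boot all_order all_algebra.
From mathcomp Require Import reals ring lra.
(* After mathcomp, whose [ssrnat.half] would otherwise hide [Defs.half]. *)
Require Import Defs.

Set Implicit Arguments.
Unset Strict Implicit.
Unset Printing Implicit Defensive.

Import Order.TTheory GRing.Theory Num.Theory.
Local Open Scope ring_scope.

Lemma has_in_all (T : Type) (P a1 a2 : pred T) (s : seq T) :
  (forall t, P t -> a1 t = a2 t) -> all P s -> has a1 s = has a2 s.
Proof.
by move=> a12; elim: s => //= t s IHs /andP[/a12-> /IHs->].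
Qed.

Lemma has_flatten (T : Type) (a : pred T) (ss : seq (seq T)) :
  has a (flatten ss) = has (has a) ss.
Proof. by elim: ss => //= s ss IHss; rewrite has_cat IHss. Qed.

Lemma all_flatten (T : Type) (a : pred T) (ss : seq (seq T)) :
  all a (flatten ss) = all (all a) ss.
Proof. by elim: ss => //= s ss IHss; rewrite all_cat IHss. Qed.

(** * Dyadic boxes, their halves and the ceiling classes *)

(** With [m = nsplit b j], the side in coordinate [j] runs from [a / 2^m] to [(a + 1) / 2^m] for a
    natural [a]. This invariant of halving ties boxes to ceilings. *)
Definition dyadic (R : realType) (d : nat) (b : box R d) : bool :=
  [forall j : 'I_d, (2%:R ^+ nsplit b j * lo b 0 j \is a Num.nat)
     && (2%:R ^+ nsplit b j * hi b 0 j == 2%:R ^+ nsplit b j * lo b 0 j + 1)].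

Definition upper_half (R : realType) (d : nat) (b : box R d) (c : 'I_d)
    (x : 'rV[R]_d) : bool :=
  (lo b 0 c + hi b 0 c) / 2%:R < x 0 c.

Lemma dyadic_cube (R : realType) (d : nat) : dyadic (cube_box R d).
Proof. by apply/forallP => j; rewrite !mxE mulr0 add0r mul1r rpred0 eqxx. Qed.

Lemma dyadic_half (R : realType) (d : nat) (b : box R d) (c : 'I_d) (u : bool) :
  dyadic b -> dyadic (half b c u).
Proof.
move=> /forallP bP; apply/forallP => j; have /andP[loN /eqP hiE] := bP j.
(* In units of [2^-(m+1)] the side runs from [2a] to [2a + 2], with midpoint [2a + 1]. *)
have mid2 : 2%:R ^+ (nsplit b j).+1 * ((lo b 0 j + hi b 0 j) / 2%:R)
    = 2%:R * (2%:R ^+ nsplit b j * lo b 0 j) + 1 :> R.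
  rewrite exprS (_ : _ * _ = 2%:R ^+ nsplit b j * lo b 0 j
                             + 2%:R ^+ nsplit b j * hi b 0 j); last by field.
  by rewrite hiE; ring.
have loN2 : 2%:R * (2%:R ^+ nsplit b j * lo b 0 j) \is a Num.nat.
  by rewrite rpredM ?natr_nat.
case: u; rewrite /= ?mxE; case: eqP => [<-|_]; rewrite ?loN ?hiE ?eqxx //.
  by rewrite mid2 rpredD ?rpred1 //= exprS -mulrA hiE; apply/eqP; ring.
by rewrite mid2 exprS -mulrA loN2 eqxx.
Qed.

Lemma dyadic_side (R : realType) (d : nat) (b : box R d) (j : 'I_d) :
  dyadic b -> 0 <= lo b 0 j < hi b 0 j.
Proof.
move=> /forallP/(_ j)/andP[/natr_ge0 lo0 /eqP hiE].
have N0 : 0 < 2%:R ^+ nsplit b j :> R by rewrite exprn_gt0.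
by rewrite -(pmulr_rge0 _ N0) lo0 -(ltr_pM2l N0) hiE ltrDl ltr01.
Qed.

(** Only the side in coordinate [c] changes, and a point at the midpoint goes to the lower half,
    whose side is closed on the right. *)
Lemma in_box_half (R : realType) (d : nat) (b : box R d) (c : 'I_d) (u : bool)
    (x : 'rV[R]_d) :
  dyadic b -> in_box (half b c u) x = in_box b x && (u == upper_half b c x).
Proof.
move=> /(dyadic_side c)/andP[lo0 ltlh].
have side_c :
    (if lo (half b c u) 0 c == 0 then 0 <= x 0 c else lo (half b c u) 0 c < x 0 c)
      && (x 0 c <= hi (half b c u) 0 c)
    = ((if lo b 0 c == 0 then 0 <= x 0 c else lo b 0 c < x 0 c)
         && (x 0 c <= hi b 0 c)) && (u == upper_half b c x).
  rewrite /upper_half; case: u; rewrite /= !mxE eqxx.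
    (* The midpoint is positive since [0 <= lo < hi], so the upper half is open on the left. *)
    rewrite ifF; last by apply/eqP => mid0; lra.
    case: (ltrP (_ / 2%:R) (x 0 c)) => [ltx|lex]; last by rewrite andbF.
    rewrite andbT; suff -> : if lo b 0 c == 0 then 0 <= x 0 c else lo b 0 c < x 0 c by [].
    by case: ifP => _; lra.
  case: (ltrP (_ / 2%:R) (x 0 c)) => [ltx|lex]; rewrite /= ?andbF ?andbT //.
  by have -> : x 0 c <= hi b 0 c; [lra | rewrite andbT].
have side_j j : j != c ->
    (lo (half b c u) 0 j = lo b 0 j) * (hi (half b c u) 0 j = hi b 0 j).
  by move=> /negPf jc; case: u side_c => _; rewrite /= !mxE jc.
apply/forallP/andP => [xP|[/forallP xP uE] j].
  have := xP c; rewrite side_c => /andP[xc uE]; split=> //.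
  apply/forallP => j; have [-> //|/side_j jE] := eqVneq j c.
  by have := xP j; rewrite !jE.
have [->|/side_j jE] := eqVneq j c; first by rewrite side_c xP uE.
by rewrite !jE.
Qed.

(** For integer endpoints, [a < t <= a + 1] is a condition on [ceil t] alone; when [a = 0] the lower
    bound becomes [0 <= t], which holds in the cube. *)
Lemma in_box_same_ceil (R : realType) (d : nat) (b : box R d)
    (x y : 'rV[R]_d) :
  in_cube x -> in_cube y -> dyadic b -> same_ceil (nsplit b) x y ->
  in_box b x = in_box b y.
Proof.
move=> hx hy /forallP bP /forallP xy; apply: eq_forallb => j.
have /andP[/natrP[a loE] /eqP hiE] := bP j.
set N := 2%:R ^+ nsplit b j : R in loE hiE.
have N0 : 0 < N by rewrite exprn_gt0.
have sideE (z : 'rV[R]_d) : in_cube z ->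
    (if lo b 0 j == 0 then 0 <= z 0 j else lo b 0 j < z 0 j) && (z 0 j <= hi b 0 j)
    = ((a == 0)%N || (a%:Z < Num.ceil (N * z 0 j))) && (Num.ceil (N * z 0 j) <= a%:Z + 1).
  move=> /(_ j)/andP[z0 _].
  rewrite ceil_gt_int ceil_le_int -(ler_pM2l N0 (z 0 j)) -(ltr_pM2l N0 (lo b 0 j)).
  rewrite hiE loE z0 rmorphD /= -pmulrn; congr (_ && _).
  by rewrite -(pnatr_eq0 R) -loE mulf_eq0 (gt_eqF N0) /=; case: eqP.
by rewrite !sideE // (eqP (xy j)).
Qed.

(** * The path of [x] down a tree *)

(* Address and box of the node containing [x] when [cs] lists the successive
   split coordinates of the nodes containing [x]. *)
Definition descend (R : realType) (d : nat) (x : 'rV[R]_d) (cs : seq 'I_d) :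
    seq bool * box R d :=
  foldl (fun vb c => (rcons vb.1 (upper_half vb.2 c x),
                      half vb.2 c (upper_half vb.2 c x)))
    ([::], cube_box R d) cs.

Lemma descend_rcons (R : realType) (d : nat) (x : 'rV[R]_d) (cs : seq 'I_d)
    (c : 'I_d) (vb := descend x cs) :
  descend x (rcons cs c) = (rcons vb.1 (upper_half vb.2 c x),
                                half vb.2 c (upper_half vb.2 c x)).
Proof. by rewrite /descend foldl_rcons. Qed.

Arguments half : simpl never.

Lemma nsplit_descend (R : realType) (d : nat) (x : 'rV[R]_d) (cs : seq 'I_d)
    (j : 'I_d) :
  nsplit (descend x cs).2 j = count_mem j cs.
Proof.
elim/last_ind: cs => [//|cs c IHcs]; rewrite descend_rcons -(cats1 cs) count_cat /=.
rewrite addn0 /half; case: upper_half; rewrite /= IHcs eq_sym;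
  by case: eqP; rewrite ?addn1 ?addn0.
Qed.

Lemma size_descend (R : realType) (d : nat) (x : 'rV[R]_d) (cs : seq 'I_d) :
  size (descend x cs).1 = size cs.
Proof.
elim/last_ind: cs => [//|cs c IHcs].
by rewrite descend_rcons !size_rcons IHcs.
Qed.

(** * The same-cell event as a condition on the coordinates met by [x] *)

Lemma in_cube_box (R : realType) (d : nat) (x : 'rV[R]_d) :
  in_cube x -> in_box (cube_box R d) x.
Proof. by move=> hx; apply/forallP => j; rewrite !mxE eqxx hx. Qed.

Lemma same_cell_dyadic (R : realType) (d : nat) (x y : 'rV[R]_d)
    (bs : seq (box R d)) :
  in_cube x -> in_cube y -> all (@dyadic R d) bs ->
  same_cell bs x y = has (fun b => in_box b x && same_ceil (nsplit b) x y) bs.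
Proof.
move=> hx hy; apply: has_in_all => b bD.
case ce: (same_ceil _ x y); last by rewrite !andbF.
by rewrite -(in_box_same_ceil hx hy bD ce) !andbT andbb.
Qed.

Lemma has_halves (R : realType) (d : nat) (x : 'rV[R]_d) (b : box R d)
    (c : 'I_d) (Q : pred bool) :
  dyadic b ->
  has (fun u => in_box (half b c u) x && Q u) [:: false; true]
  = in_box b x && Q (upper_half b c x).
Proof.
move=> bD; rewrite /= !in_box_half // orbF.
by case: (upper_half b c x); rewrite ?andbF ?andbT ?orbF.
Qed.

Lemma dyadic_centered (R : realType) (d : nat) (ch : seq bool -> 'I_d) (l : nat) :
  all (fun vb => dyadic vb.2) (centered_nodes R ch l).
Proof.
elim: l => [|l IHl]; first by rewrite /= dyadic_cube.
rewrite /= all_flatten all_map; apply: sub_all IHl => vb bD.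
by rewrite /= !dyadic_half.
Qed.

Lemma dyadic_directional (R : realType) (d : nat) (cs : seq 'I_d) :
  all (@dyadic R d) (foldl (@split_all R d) [:: cube_box R d] cs).
Proof.
elim/last_ind: cs => [|cs c IHcs]; first by rewrite /= dyadic_cube.
rewrite foldl_rcons all_flatten all_map; apply: sub_all IHcs => b bD.
by rewrite /= !dyadic_half.
Qed.

(* The choices met by [x]: unlike in a directional tree, each one is read at a
   node which depends on the previous ones. *)
Fixpoint route (R : realType) (d : nat) (x : 'rV[R]_d) (ch : seq bool -> 'I_d)
    (l : nat) : seq 'I_d :=
  if l is l'.+1 then
    rcons (route x ch l') (ch (descend x (route x ch l')).1)
  else [::].

(** Exactly one node of level [l] contains [x], so the existential evaluates [Q] there. [Q] stays
    general because the induction step applies the hypothesis to [Q] composed with one more split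
    towards [x]. *)
Lemma has_centered (R : realType) (d : nat) (x : 'rV[R]_d)
    (ch : seq bool -> 'I_d) (l : nat) (Q : pred (seq bool * box R d)) :
  in_cube x ->
  has (fun vb => in_box vb.2 x && Q vb) (centered_nodes R ch l)
  = Q (descend x (route x ch l)).
Proof.
move=> hx; elim: l Q => [|l IHl] Q; first by rewrite /= in_cube_box ?orbF.
rewrite /= descend_rcons -(IHl (fun vb =>
  Q (rcons vb.1 (upper_half vb.2 (ch vb.1) x),
     half vb.2 (ch vb.1) (upper_half vb.2 (ch vb.1) x)))).
rewrite has_flatten has_map; apply: has_in_all (dyadic_centered R ch l).
move=> vb bD; rewrite -(has_halves x _ (fun u => Q (rcons vb.1 u, _ u))) //.
Qed.

Lemma has_directional (R : realType) (d : nat) (x : 'rV[R]_d) (cs : seq 'I_d)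
    (Q : pred (box R d)) :
  in_cube x ->
  has (fun b => in_box b x && Q b) (foldl (@split_all R d) [:: cube_box R d] cs)
  = Q (descend x cs).2.
Proof.
move=> hx; elim/last_ind: cs Q => [|cs c IHcs] Q.
  by rewrite /= in_cube_box ?orbF.
rewrite descend_rcons foldl_rcons -(IHcs (fun b => Q (half b c (upper_half b c x)))).
rewrite has_flatten has_map; apply: has_in_all (dyadic_directional R cs).
by move=> b bD; rewrite -(has_halves x _ (fun u => Q (half b c u))).
Qed.

Definition count_ceil (R : realType) (d : nat) (x y : 'rV[R]_d) (cs : seq 'I_d) :
    bool :=
  same_ceil (fun j => count_mem j cs) x y.

Lemma same_ceil_descend (R : realType) (d : nat) (x y : 'rV[R]_d)
    (cs : seq 'I_d) :
  same_ceil (nsplit (descend x cs).2) x y = count_ceil x y cs.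
Proof. by apply: eq_forallb => j; rewrite nsplit_descend. Qed.

Lemma same_cell_centered (R : realType) (d k : nat) (x y : 'rV[R]_d)
    (w : {ffun node k -> 'I_d}) :
  in_cube x -> in_cube y ->
  same_cell (centered_tree R w) x y
  = count_ceil x y (route x (fun v => w (insub_bseq k.-1 v)) k).
Proof.
move=> hx hy; rewrite same_cell_dyadic // ?all_map ?dyadic_centered // has_map.
rewrite -same_ceil_descend.
exact: (has_centered _ _ (fun vb => same_ceil (nsplit vb.2) x y)).
Qed.

Lemma same_cell_directional (R : realType) (d k : nat) (x y : 'rV[R]_d)
    (w : {ffun 'I_k -> 'I_d}) :
  in_cube x -> in_cube y ->
  same_cell (directional_tree R w) x y = count_ceil x y (codom w).
Proof.
move=> hx hy; rewrite same_cell_dyadic ?dyadic_directional //.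
rewrite -same_ceil_descend.
exact: (has_directional _ (fun b => same_ceil (nsplit b) x y)).
Qed.

(** * Cylinder events and image laws of i.i.d. families *)

(** The sum over outcomes factors over [I]: an index in the image of [f] contributes [1 / d], any
    other contributes [d * (1 / d) = 1], and injectivity gives the image [#|J|] elements. *)
Lemma prob_iid_cylinder (R : realType) (d : nat) (I J : finType) (f : J -> I)
    (c : J -> 'I_d) :
  (0 < d)%N -> injective f ->
  prob_iid R (fun w : {ffun I -> 'I_d} => [forall j, w (f j) == c j])
  = d%:R^-1 ^+ #|J|.
Proof.
(* [Q i] is the set of values allowed at [i]: a singleton on the image of [f], everything
   elsewhere. *)
move=> d_gt0 f_inj; pose Q i a := [forall j, (f j == i) ==> (a == c j)].
have QP (w : {ffun I -> 'I_d}) : [forall j, w (f j) == c j] = (w \in family Q).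
  apply/forallP/forallP => [wc i|wQ j].
    by apply/forallP => j; apply/implyP => /eqP <-.
  by have /forallP/(_ j) := wQ (f j); rewrite eqxx.
rewrite /prob_iid (eq_bigl _ _ QP) -(bigA_distr_big_dep Q (fun _ _ => d%:R^-1)).
rewrite -(card_codom f_inj) -prodr_const [RHS]big_mkcond.
apply: eq_bigr => i _; case: ifPn => [/codomP[j ->]|iNf].
  rewrite (big_pred1 (c j)) // => a; apply/forallP/eqP => [/(_ j)|-> j'].
    by rewrite eqxx => /eqP.
  by apply/implyP => /eqP/f_inj ->.
rewrite (eq_bigl predT) => [|a]; last first.
  apply/forallP => j; apply/implyP => /eqP fji.
  by rewrite -fji codom_f in iNf.
by rewrite sumr_const card_ord -[LHS]mulr_natl divff // pnatr_eq0 -lt0n.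
Qed.

(** Each fiber of [phi] is a cylinder of mass [d^-#|J|], the mass of a single outcome on [J]. The
    indices [f c] may depend on the outcome [c], which allows adaptive reading. *)
Lemma prob_iid_pushforward (R : realType) (d : nat) (I J : finType)
    (phi : {ffun I -> 'I_d} -> {ffun J -> 'I_d})
    (f : {ffun J -> 'I_d} -> J -> I) (E : pred {ffun J -> 'I_d}) :
  (0 < d)%N -> (forall c, injective (f c)) ->
  (forall w c, (phi w == c) = [forall j, w (f c j) == c j]) ->
  prob_iid R (fun w => E (phi w)) = prob_iid R E.
Proof.
move=> d_gt0 f_inj phiE; rewrite /prob_iid (partition_big phi E) //=.
apply: eq_bigr => c Ec; rewrite [RHS]prodr_const -(prob_iid_cylinder R c d_gt0 (f_inj c)).
apply: eq_bigl => w; rewrite -phiE; case: eqP => [->|_]; rewrite ?Ec //.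
by rewrite andbF.
Qed.

(** * The law of the coordinates met in a centered tree *)

Lemma size_route (R : realType) (d : nat) (x : 'rV[R]_d)
    (ch : seq bool -> 'I_d) (l : nat) :
  size (route x ch l) = l.
Proof. by elim: l => //= l IHl; rewrite size_rcons IHl. Qed.

Lemma routeE (R : realType) (d : nat) (x : 'rV[R]_d)
    (ch : seq bool -> 'I_d) (l : nat) :
  route x ch l = mkseq (fun i => ch (descend x (route x ch i)).1) l.
Proof. by elim: l => // l IHl; rewrite mkseqS -IHl. Qed.

Lemma codom_ord (T : Type) (k : nat) (g : nat -> T) :
  codom [ffun i : 'I_k => g i] = mkseq g k.
Proof.
rewrite /codom /image_mem (eq_map (ffunE _)).
by rewrite (map_comp g val) val_enum_ord.
Qed.

Lemma take_route (R : realType) (d : nat) (x : 'rV[R]_d)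
    (ch : seq bool -> 'I_d) (i l : nat) :
  (i <= l)%N -> take i (route x ch l) = route x ch i.
Proof.
elim: l => [|l IHl]; first by rewrite leqn0 => /eqP ->.
rewrite leq_eqVlt => /predU1P[->|il]; first by rewrite take_oversize ?size_route.
by rewrite /= -cats1 takel_cat ?size_route // IHl.
Qed.

Lemma p_cenE (R : realType) (d k : nat) (x y : 'rV[R]_d) :
  (0 < d)%N -> in_cube x -> in_cube y ->
  p_cen k x y
  = prob_iid R (fun w : {ffun 'I_k -> 'I_d} => count_ceil x y (codom w)).
Proof.
move=> d_gt0 hx hy; pose ch (w : {ffun node k -> 'I_d}) v := w (insub_bseq k.-1 v).
(* [phi w] is the word of choices met by [x]; [f c i] is the node of depth [i] that [x] reaches by
   following the first [i] letters of [c]. *)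
pose phi w : {ffun 'I_k -> 'I_d} :=
  [ffun i : 'I_k => ch w (descend x (route x (ch w) i)).1].
pose f (c : {ffun 'I_k -> 'I_d}) (i : 'I_k) : node k :=
  insub_bseq k.-1 (descend x (take i (codom c))).1.
have codom_phi w : codom (phi w) = route x (ch w) k.
  by rewrite (codom_ord _ (fun i => ch w (descend x (route x (ch w) i)).1)) -routeE.
rewrite -(@prob_iid_pushforward _ _ _ _ phi f) => [||c|w c] //.
- by apply: eq_bigl => w; rewrite same_cell_centered // codom_phi.
- have szc : size (codom c) = k by rewrite size_codom card_ord.
  (* The nodes met by [x] are distinct because their depths are. *)
  have szf i : size (f c i) = i.
    rewrite /f /insub_bseq insubdK ?size_descend ?size_take ?szc ?ltn_ord //.
    (* The depth [i < k] satisfies [i <= k.-1], so [insub_bseq] leaves the address unchanged. *)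
    by rewrite unfold_in size_descend size_take szc ltn_ord -ltnS (ltn_predK (ltn_ord i)).
  by move=> i j fij; apply: val_inj; rewrite /= -szf fij szf.
- apply/eqP/forallP => [<- i|wc].
    by rewrite /f codom_phi take_route 1?ltnW ?ffunE.
  have nthc (i : 'I_k) : c i = nth (c i) (codom c) i.
    by rewrite (nth_map i) ?size_enum_ord // nth_ord_enum.
  (* If the first [l] letters of the route agree with [c], the next one is read at node [f c l],
     where [wc] prescribes the letter [c l]. *)
  have wE l : (l <= k)%N -> route x (ch w) l = take l (codom c).
    elim: l => [|l IHl] lk; first by rewrite take0.
    have szc : (l < size (codom c))%N by rewrite size_codom card_ord.
    rewrite /= IHl 1?ltnW // (take_nth (c (Ordinal lk))) //; congr rcons.
    by rewrite -(nthc (Ordinal lk)); exact/eqP/(wc (Ordinal lk)).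
  apply/ffunP => i; rewrite ffunE wE 1?ltnW //.
  exact/eqP/wc.
Qed.

Lemma p_sdE (R : realType) (d k : nat) (x y : 'rV[R]_d) :
  in_cube x -> in_cube y ->
  p_sd k x y
  = prob_iid R (fun w : {ffun 'I_k -> 'I_d} => count_ceil x y (codom w)).
Proof. by move=> hx hy; apply: eq_bigl => w; rewrite same_cell_directional. Qed.

(** * Counting words with prescribed letter counts *)

Lemma sum_tupleS (T : finType) (n : nat) (F : n.+1.-tuple T -> nat) :
  (\sum_t F t = \sum_(a : T) \sum_(t : n.-tuple T) F [tuple of a :: t])%N.
Proof.
rewrite pair_bigA (reindex (fun p : T * n.-tuple T => [tuple of p.1 :: p.2])) //.
exists (fun t => (thead t, [tuple of behead t])) => [[a t] _|t _] /=.
  by rewrite theadE; congr pair; apply: val_inj.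
by rewrite [RHS]tuple_eta.
Qed.

Lemma sum_eq_op (T : finType) (a : T) : (\sum_j (a == j) = 1)%N.
Proof.
by rewrite (bigD1 a) //= eqxx big1 // => j /negPf ja; rewrite eq_sym ja.
Qed.

(** Induction on the first letter [a]: deleting it lowers [m a] by one, and the weights [m a] add up
    to [n + 1]. The product form avoids division, and the indicator covers every [m], whatever its
    total. *)
Lemma multinomial_count (T : finType) (n : nat) (m : T -> nat) :
  ((\sum_(t : n.-tuple T) [forall j, count_mem j t == m j]) * \prod_j (m j)`!
   = (\sum_j m j == n) * n`!)%N.
Proof.
elim: n m => [|n IHn] m.
  rewrite (big_pred1 [tuple]) => [|t]; last exact/esym/eqP/tuple0.
  rewrite sum_nat_eq0; under eq_forallb do rewrite eq_sym.
  case: forallP => [m0|_]; last by rewrite !mul0n.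
  by rewrite big1 // => j _; rewrite (eqP (m0 j)).
rewrite sum_tupleS big_distrl /=.
have -> : ((\sum_j m j == n.+1) * n.+1`!
           = \sum_j m j * ((\sum_j m j == n.+1) * n`!))%N.
  by rewrite -big_distrl /= factS; case: eqP => [->|_]; rewrite ?mul1n // muln0.
(* If [m a = 0], no word starting with [a] has the counts [m]. *)
apply: eq_bigr => a _; case ma: (m a) => [|ma'].
  rewrite mul0n big1 // => t _; case: forallP => // /(_ a).
  by rewrite /= eqxx ma.
(* Counts left after the first letter; the truncated subtraction is exact because [m a > 0] here. *)
pose m' j := (m j - (a == j))%N.
have mE j : m j = ((a == j) + m' j)%N.
  by rewrite /m' subnKC //; case: eqP => [<-|//]; rewrite ma.
have -> : (\prod_j (m j)`! = m a * \prod_j (m' j)`!)%N.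
  rewrite (bigD1 a) //= [in RHS](bigD1 a) //= mulnA; congr muln.
    by rewrite mE eqxx factS.
  by apply: eq_bigr => j /negPf ja; rewrite mE eq_sym ja.
rewrite mulnCA -ma; congr muln.
rewrite (eq_bigr (fun t : n.-tuple T => [forall j, count_mem j t == m' j] : nat)).
  rewrite IHn; congr (_ * _)%N; congr nat_of_bool.
  rewrite (eq_bigr _ (fun j _ => mE j)) big_split /=.
  by rewrite sum_eq_op add1n.
move=> t _; congr nat_of_bool; apply: eq_forallb => j.
by rewrite mE eqn_add2l.
Qed.

Lemma sum_tuple_ffun (R : realType) (T : finType) (k : nat) (F : seq T -> R) :
  \sum_(w : {ffun 'I_k -> T}) F (codom w) = \sum_(t : k.-tuple T) F t.
Proof.
rewrite (reindex (fun t : k.-tuple T => [ffun i => tnth t i])).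
  apply: eq_bigr => t _; congr F; rewrite /codom /image_mem (eq_map (ffunE _)).
  exact: map_tnth_enum.
exists (fun w : {ffun 'I_k -> T} => [tuple w i | i < k]) => [t _|w _].
  by apply: eq_from_tnth => i; rewrite tnth_mktuple ffunE.
by apply/ffunP => i; rewrite ffunE tnth_mktuple.
Qed.

Lemma multinomial_natr (R : realType) (T : finType) (n : nat) (m : T -> nat) :
  (\sum_j m j)%N = n ->
  (\sum_(t : n.-tuple T) [forall j, count_mem j t == m j])%:R
  = n`!%:R / \prod_j (m j)`!%:R :> R.
Proof.
move=> mn; apply: canRL (mulfK _) _.
  by rewrite prodf_seq_neq0; apply/allP => j _; rewrite pnatr_eq0 -lt0n fact_gt0.
by rewrite -natr_prod -natrM multinomial_count mn eqxx mul1n.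
Qed.

Lemma sum_count_mem (T : finType) (s : seq T) :
  (\sum_j count_mem j s = size s)%N.
Proof.
elim: s => [|a s IHs]; first by rewrite big1.
by rewrite /= big_split /= IHs sum_eq_op add1n.
Qed.

(** * Grouping words by letter counts *)

Lemma prob_count_ceil (R : realType) (d k : nat) (x y : 'rV[R]_d) :
  prob_iid R (fun w : {ffun 'I_k -> 'I_d} => count_ceil x y (codom w))
  = K_cen k x y.
Proof.
rewrite /prob_iid prodr_const card_ord big_mkcond /= (sum_tuple_ffun k (fun s =>
  if count_ceil x y s then d%:R^-1 ^+ k else 0)) -big_mkcond /=.
(* A letter count in a word of length [k] is at most [k], so [inord] does not fall back on its
   default. *)
pose kk (t : k.-tuple 'I_d) : {ffun 'I_d -> 'I_k.+1} :=
  [ffun j => inord (count_mem j t)].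
have kkE t j : kk t j = count_mem j t :> nat.
  by rewrite ffunE inordK // ltnS -[leqRHS](size_tuple t) count_size.
rewrite (partition_big kk (fun m : {ffun 'I_d -> 'I_k.+1} => (\sum_j m j)%N == k))
  => [|t _] /=; last first.
  by under eq_bigr do rewrite kkE; rewrite sum_count_mem size_tuple.
apply: eq_bigr => m /eqP mk.
(* The multinomial coefficient is expanded back into a sum over words, so that both sides are
   compared word by word. *)
rewrite -(multinomial_natr R mk) natr_sum mulrAC 2!mulr_suml big_mkcond /=.
apply: eq_bigr => t _.
have -> : [forall j, count_mem j t == m j] = (kk t == m).
  apply/forallP/eqP => [tm|<- j]; last by rewrite kkE.
  by apply/ffunP => j; apply: val_inj; rewrite /= kkE; apply/eqP.
rewrite andbC; case: eqP => [<-|_] /=; last by rewrite !mul0r.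
rewrite !mul1r /count_ceil /same_ceil.
under [in LHS]eq_forallb do rewrite -kkE.
case: forallP => [all_eq|].
  by rewrite big1 ?mul1r // => j _; rewrite all_eq.
move/forallP; rewrite negb_forall => /existsP[j /negPf neq].
by rewrite (bigD1 j) //= neq !mul0r.
Qed.

Theorem theorem1 (R : realType) (d : nat) (hd : (1 <= d)%N) (k : nat)
    (x y : 'rV[R]_d) (hx : in_cube x) (hy : in_cube y) :
  p_sd k x y = p_cen k x y /\ p_cen k x y = K_cen k x y.
Proof. by rewrite p_sdE // p_cenE // prob_count_ceil. Qed.
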